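(* Let $n\ge 1$ be an integer, let $p\in[1/2,1)$, $q=1-p$, $\mu=p-q$ and $z=pq$. Let $Z_{n,p}$ be the net profit of Player 1 in the first-to-reach-$n$ game with constant round-winning probability $p$, and let $E_{n,p}=\mathbb{E}Z_{n,p}$. Then $$E_{n,p}=n\mu\sum_{j=0}^{n-1}C_j z^j,$$ where $C_j=\frac{(2j)!}{j!\,(j+1)!}$ are the Catalan numbers.
   Context: First-to-reach-$n$ game, constant model: two players play a sequence of independent rounds; in each round Player 1 wins with probability $p$ and Player 2 wins with probability $q=1-p$. The game stops the first time one of the players has won exactly $n$ rounds (so it lasts at most $2n-1$ rounds); that player is the overall winner. Let $W_{n,p}\in\{0,1,\dots,n-1\}$ be the number of rounds won by the losing player when the game stops. The overall winner receives $n-W_{n,p}$ from the loser, so the net profit of Player 1 is $Z_{n,p}=(n-W_{n,p})\mathbf{1}_{\{\text{Player 1 won}\}}+(W_{n,p}-n)\mathbf{1}_{\{\text{Player 2 won}\}}$. *)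

(* Defs.v *)
From mathcomp Require Import all_boot all_order all_algebra finmap.
From mathcomp Require Import all_classical all_reals all_analysis.

Set Implicit Arguments.
Unset Strict Implicit.
Unset Printing Implicit Defensive.

Import Order.TTheory GRing.Theory Num.Theory.
Local Open Scope classical_set_scope.
Local Open Scope ring_scope.

Definition mutually_independent (R : realType) (d d' : measure_display)
    (T : measurableType d) (T' : measurableType d') (P : probability T R)
    (I : choiceType) (X : I -> {RV P >-> T'}) : Prop :=
  forall (J : {fset I}) (B : I -> set T'), (forall i, measurable (B i)) ->
    P (\bigcap_(i in [set` J]) (X i @^-1` B i)) =
    (\prod_(i <- J) P (X i @^-1` B i))%E.

(* A play is described by w : nat -> bool, where w i holds iff Player 1 wins
   the round of index i (counted from 0).  The game for n looks at w only up to
   [duration n w]; continuing the rounds past that time is harmless. *)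
Definition wins1 (w : nat -> bool) (t : nat) : nat := count w (iota 0 t).
Definition wins2 (w : nat -> bool) (t : nat) : nat := count (predC w) (iota 0 t).

Definition reached (n : nat) (w : nat -> bool) (t : nat) : bool :=
  (wins1 w t == n) || (wins2 w t == n).

Lemma ex_reached (n : nat) (w : nat -> bool) : exists t, reached n w t.
Proof.
have ex : exists t, (n <= wins1 w t)%N || (n <= wins2 w t)%N.
  exists (n + n)%N; rewrite -[_ || _]negbK negb_or -!ltnNge; apply/negP.
  move=> /andP[h1 h2]; have := count_predC w (iota 0 (n + n)).
  rewrite size_iota -/(wins1 w _) -/(wins2 w _) => e.
  by have := leq_add h1 (ltnW h2); rewrite addSn e ltnn.
case: (ex_minnP ex) => -[|t] ht tmin.
  by exists 0%N; move: ht; rewrite /reached /wins1 /wins2 /= !leqn0 !(eq_sym n).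
exists t.+1.
have : ~~ ((n <= wins1 w t) || (n <= wins2 w t))%N.
  by apply/negP => /tmin; rewrite ltnn.
rewrite negb_or -!ltnNge => /andP[l1 l2]; move: ht; rewrite /reached.
have s1 : wins1 w t.+1 = (wins1 w t + w t)%N.
  by rewrite /wins1 -addn1 iotaD count_cat /= addn0 add0n.
have s2 : wins2 w t.+1 = (wins2 w t + ~~ w t)%N.
  by rewrite /wins2 -addn1 iotaD count_cat /= addn0 add0n.
have b1 : (wins1 w t.+1 <= n)%N.
  by rewrite s1 (leq_trans _ l1)// -addn1 leq_add2l leq_b1.
have b2 : (wins2 w t.+1 <= n)%N.
  by rewrite s2 (leq_trans _ l2)// -addn1 leq_add2l leq_b1.
by rewrite 2!eqn_leq b1 b2.
Qed.

Definition duration (n : nat) (w : nat -> bool) : nat := ex_minn (ex_reached n w).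

Definition player1_won (n : nat) (w : nat -> bool) : bool :=
  wins1 w (duration n w) == n.
Definition player2_won (n : nat) (w : nat -> bool) : bool :=
  wins2 w (duration n w) == n.

Definition loser_wins (n : nat) (w : nat -> bool) : nat :=
  if player1_won n w then wins2 w (duration n w) else wins1 w (duration n w).

Definition net_profit (R : realType) (n : nat) (w : nat -> bool) : R :=
  (n%:R - (loser_wins n w)%:R) * (player1_won n w)%:R +
  ((loser_wins n w)%:R - n%:R) * (player2_won n w)%:R.

Definition catalan (R : realType) (j : nat) : R :=
  ((2 * j)`!)%:R / ((j`!)%:R * ((j.+1)`!)%:R).

(* Main.v *)
Require Import Defs.
From mathcomp Require Import all_boot all_order all_algebra finmap.
From mathcomp Require Import all_classical all_reals all_analysis.
From mathcomp Require Import measurable_realfun ring zify.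

(* The net profit is the lead of Player 1 at the end of the game, so its
   expected value satisfies F(a, b) = p F(a-1, b) + q F(a, b-1), where a and b
   are the numbers of wins the players still need and F(a, b) = b - a as soon as
   a b = 0.  This recursion is solved by
     F(a, b) = f(a, b; p, q) - f(b, a; q, p),
     f(a, b; x, y) = x^a sum_(k < b) (b - k) C(a + k - 1, k) y^k,
   the k-th term being the contribution of the games won against k wins.
   With A_n(x) = sum_(k < n) C(n + k, k) x^k, multiplication by 1 - x telescopes
   by Pascal's rule; this gives F(n, n) = n (p - q) (p^n A_n(q) + q^n A_n(p)),
   and shows that the last factor grows by C_n (pq)^n from n to n + 1. *)

Set Implicit Arguments.
Unset Strict Implicit.
Unset Printing Implicit Defensive.

Import Order.TTheory GRing.Theory Num.Theory.
Local Open Scope classical_set_scope.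
Local Open Scope ring_scope.

(** * The recursion for the expected gain and its solution *)

(* For a = 0 the truncated (a + k).-1 leaves only the term k = 0, equal to b. *)
Definition first_hit_gain (A : comNzRingType) (x y : A) (a b : nat) : A :=
  x ^+ a * \sum_(k < b) (b%:R - k%:R) * 'C((a + k).-1, k)%:R * y ^+ k.

Lemma first_hit_gain0l (A : comNzRingType) (x y : A) (b : nat) :
  first_hit_gain x y 0 b = b%:R.
Proof.
rewrite /first_hit_gain mul1r; case: b => [|b]; first by rewrite big_ord0.
rewrite big_ord_recl big1 => [|k _]; last by rewrite bin_small// mulr0 mul0r.
by rewrite bin0 subr0 !mulr1 addr0.
Qed.

Lemma first_hit_gain0r (A : comNzRingType) (x y : A) (a : nat) :
  first_hit_gain x y a 0 = 0.
Proof. by rewrite /first_hit_gain big_ord0 mulr0. Qed.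

(** Pascal's rule splits the coefficient of each term with positive index: one part keeps the index
    and feeds the [x] summand, the other lowers it by one and feeds the [y] summand. *)
Lemma first_hit_gainS (A : comNzRingType) (x y : A) (a b : nat) :
  first_hit_gain x y a.+1 b.+1 =
  x * first_hit_gain x y a b.+1 + y * first_hit_gain x y a.+1 b.
Proof.
rewrite /first_hit_gain !(big_ord_recl b) !bin0 /=.
under eq_bigr => k _.
  rewrite /bump add1n addnS binS natrD.
  have -> : b.+1%:R - k.+1%:R = b%:R - k%:R :> A.
    by rewrite -(natr1 b) -(natr1 k); ring.
  rewrite mulrDr mulrDl exprS [X in _ + X]mulrCA; over.
rewrite big_split -mulr_sumr/=.
under [in RHS]eq_bigr => k _.
  rewrite /bump add1n addnS/= exprS.
  have -> : b.+1%:R - k.+1%:R = b%:R - k%:R :> A.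
    by rewrite -(natr1 b) -(natr1 k); ring.
  over.
by rewrite exprS; ring.
Qed.

Definition expected_gain (A : comNzRingType) (x y : A) (a b : nat) : A :=
  first_hit_gain x y a b - first_hit_gain y x b a.

Lemma expected_gain_hit (A : comNzRingType) (x y : A) (a b : nat) :
  (a == 0%N) || (b == 0%N) -> expected_gain x y a b = b%:R - a%:R.
Proof.
by rewrite /expected_gain => /orP[] /eqP ->;
  rewrite first_hit_gain0l first_hit_gain0r.
Qed.

Lemma expected_gainS (A : comNzRingType) (x y : A) (a b : nat) :
  expected_gain x y a.+1 b.+1 =
  x * expected_gain x y a b.+1 + y * expected_gain x y a.+1 b.
Proof. by rewrite /expected_gain !first_hit_gainS; ring. Qed.

(** * Truncated binomial sums and Catalan numbers *)

Section hockey_stick.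
Variables (A : comNzRingType) (x : A).

(** By Pascal, C(n+1+k, k) - C(n+k, k-1) = C(n+k, k); only the shifted top term survives. *)
Lemma mul1Bx_sum_bin (n m : nat) :
  (1 - x) * \sum_(k < m.+1) 'C(n.+1 + k, k)%:R * x ^+ k =
  \sum_(k < m.+1) 'C(n + k, k)%:R * x ^+ k - 'C((n + m).+1, m)%:R * x ^+ m.+1.
Proof.
elim: m => [|m IH]; first by rewrite !big_ord1 !bin0 expr0 expr1; ring.
rewrite big_ord_recr [in RHS]big_ord_recr mulrDr IH /= !addSn !addnS.
by rewrite (binS (n + m).+1) natrD !exprS; ring.
Qed.

(** Absorption: (k+1) C(n+k+1, k+1) = (n+1) C(n+1+k, k). *)
Lemma sum_mulk_bin (n m : nat) :
  \sum_(k < m.+1) k%:R * 'C(n + k, k)%:R * x ^+ k =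
  n.+1%:R * x * \sum_(k < m) 'C(n.+1 + k, k)%:R * x ^+ k.
Proof.
rewrite big_ord_recl !mul0r add0r mulr_sumr; apply: eq_bigr => k _.
rewrite /= /bump add1n exprS addnS -natrM -mul_bin_diag/=.
have -> : ((n + k).+1 * 'C(n + k, k))%N = (n.+1 * 'C(n.+1 + k, k))%N.
  rewrite -(bin_sub (leq_addl n k)) -(bin_sub (leq_addl n.+1 k)) !addnK.
  by rewrite -mul_bin_diag addSn.
by rewrite natrM; ring.
Qed.

(** Evaluates the sum inside [first_hit_gain] on the diagonal. The boundary term, once multiplied by
    the power of the other variable, is symmetric and cancels in [expected_gain]. *)
Lemma sum_weighted_bin (n : nat) :
  \sum_(k < n.+1) (n.+1%:R - k%:R) * 'C(n + k, k)%:R * x ^+ k =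
  n.+1%:R * ((1 - 2 * x) * \sum_(k < n.+1) 'C(n.+1 + k, k)%:R * x ^+ k +
             2 * 'C((n + n).+1, n)%:R * x ^+ n.+1).
Proof.
under eq_bigr => k _ do rewrite -mulrA mulrBl.
rewrite sumrB -mulr_sumr; under [X in _ - X]eq_bigr => k _ do rewrite mulrA.
rewrite sum_mulk_bin.
have := mul1Bx_sum_bin n n; rewrite big_ord_recr/= addSn => h.
have -> : \sum_(k < n.+1) 'C(n + k, k)%:R * x ^+ k =
  (1 - x) * (\sum_(k < n) 'C(n.+1 + k, k)%:R * x ^+ k +
     'C((n + n).+1, n)%:R * x ^+ n) + 'C((n + n).+1, n)%:R * x ^+ n.+1.
  by rewrite h; ring.
by rewrite exprS; ring.
Qed.

End hockey_stick.

(** The shape in which the Catalan number appears as an increment in [sum_catalan]. *)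
Lemma catalan_bin (R : realType) (n : nat) :
  catalan R n = 2 * 'C(n + n, n)%:R - 'C((n + n).+1, n)%:R.
Proof.
rewrite /catalan mul2n -addnn.
have nf m : (m`!)%:R != 0 :> R by rewrite pnatr_eq0 -lt0n fact_gt0.
have e1 : 'C(n + n, n)%:R = (n + n)`!%:R / (n`!%:R * n`!%:R) :> R.
  apply: (canRL (mulfK _)); first by rewrite mulf_neq0.
  by rewrite -!natrM -(bin_fact (leq_addl n n)) addnK.
have e2 : 'C((n + n).+1, n)%:R = (n + n).+1`!%:R / (n`!%:R * n.+1`!%:R) :> R.
  apply: (canRL (mulfK _)); first by rewrite mulf_neq0.
  by rewrite -!natrM -addSn -(bin_fact (leq_addl n.+1 n)) addnK.
have n1 : n.+1%:R != 0 :> R by rewrite pnatr_eq0.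
rewrite e1 e2 !factS !natrM -!(natr1 (n + n)) natrD -!(natr1 n) in n1 *.
by field; rewrite n1 nf.
Qed.

(** From [n] to [n.+1] each half gains C(2n, n) (xy)^n from its new top index, and the two boundary
    terms remove C(2n+1, n) (xy)^n (x + y) in all. *)
Lemma sum_catalan (R : realType) (x y : R) (n : nat) : x + y = 1 ->
  \sum_(0 <= j < n) catalan R j * (x * y) ^+ j =
  x ^+ n * (\sum_(k < n) 'C(n + k, k)%:R * y ^+ k) +
  y ^+ n * (\sum_(k < n) 'C(n + k, k)%:R * x ^+ k).
Proof.
move=> xy1; elim: n => [|n IH].
  by rewrite big_geq// !big_ord0 !mulr0 addr0.
rewrite big_nat_recr//= IH !exprS.
have ex : x = 1 - y by rewrite -xy1 addrK.
have ey : y = 1 - x by rewrite -xy1; ring.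
have hy := mul1Bx_sum_bin y n n; rewrite -ex in hy.
have hx := mul1Bx_sum_bin x n n; rewrite -ey in hx.
rewrite [x * _ * _]mulrAC [y * _ * _]mulrAC.
rewrite hx hy catalan_bin !big_ord_recr/= exprMn !exprS.
by rewrite ey; ring.
Qed.

Lemma expected_gain_diag (R : realType) (x y : R) (n : nat) : x + y = 1 ->
  expected_gain x y n n =
  n%:R * (x - y) * \sum_(0 <= j < n) catalan R j * (x * y) ^+ j.
Proof.
case: n => [|n] xy1.
  by rewrite /expected_gain !first_hit_gain0r subrr !mul0r.
rewrite /expected_gain /first_hit_gain !sum_weighted_bin (sum_catalan _ xy1).
have -> : x = 1 - y by rewrite -xy1 addrK.
by ring.
Qed.

(** * From the game to the recursion, through cylinders of finite histories *)

Lemma net_profit_wins (R : realType) (n : nat) (w : nat -> bool) :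
  net_profit R n w =
  (wins1 w (duration n w))%:R - (wins2 w (duration n w))%:R.
Proof.
have : reached n w (duration n w) by rewrite /duration; case: ex_minnP.
rewrite /net_profit /loser_wins /player2_won /player1_won /reached.
case: (wins1 w _ =P n) => [-> _|_ /= /eqP ->].
  case: (wins2 w _ =P n) => [->|_]; first by rewrite subrr !mul0r addr0.
  by rewrite mulr1 mulr0 addr0.
by rewrite eqxx mulr0 mulr1 add0r.
Qed.

Lemma duration_eq (n : nat) (w : nat -> bool) (t : nat) :
  reached n w t -> (t <= duration n w)%N -> duration n w = t.
Proof.
rewrite /duration; case: ex_minnP => m _ mmin rt tm.
by apply/eqP; rewrite eqn_leq tm mmin.
Qed.

Section cylinder.
Context (R : realType) (d : measure_display) (T : measurableType d).
Variables (P : probability T R) (X : nat -> {RV P >-> bool}).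

Definition play (x : T) : nat -> bool := fun i => X i x.

Definition cylinder (c : seq bool) : set T :=
  [set x | mkseq (play x) (size c) = c].

Lemma cylinder_nil : cylinder [::] = setT.
Proof. by apply/seteqP; split. Qed.

Lemma cylinder_rcons (c : seq bool) (b : bool) :
  cylinder (rcons c b) = cylinder c `&` X (size c) @^-1` [set b].
Proof.
apply/seteqP; split => x /=; rewrite /cylinder/= size_rcons mkseqS.
  by move=> /rcons_inj[].
by rewrite /play => -[-> ->].
Qed.

Lemma cylinder_split (c : seq bool) :
  cylinder c = cylinder (rcons c true) `|` cylinder (rcons c false).
Proof.
rewrite !cylinder_rcons -setIUr; apply/seteqP; split=> x; last by case.
by move=> cx; split => //=; case: (X (size c) x); [left|right].
Qed.

Lemma cylinder_disj (c : seq bool) :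
  [disjoint cylinder (rcons c true) & cylinder (rcons c false)].
Proof.
rewrite disj_set2E !cylinder_rcons; apply/eqP/seteqP; split => x //=.
by move=> [[_ ->] [_ ]].
Qed.

Lemma measurable_cylinder (c : seq bool) : measurable (cylinder c).
Proof.
elim/last_ind: c => [|c b IH]; first by rewrite cylinder_nil.
by rewrite cylinder_rcons; apply: measurableI => //; exact: measurable_funPTI.
Qed.

Lemma wins1_cylinder (c : seq bool) (x : T) : cylinder c x ->
  wins1 (play x) (size c) = count id c.
Proof. by move=> cx; rewrite -{2}cx /mkseq count_map. Qed.

Lemma wins2_cylinder (c : seq bool) (x : T) : cylinder c x ->
  wins2 (play x) (size c) = count negb c.
Proof. by move=> cx; rewrite -{2}cx /mkseq count_map. Qed.

(** Gives a cylinder the form to which [mutually_independent] applies. *)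
Lemma cylinder_bigcap (c : seq bool) :
  cylinder c = \bigcap_(i in [set` [fset i in iota 0 (size c)]%fset])
                  X i @^-1` [set nth false c i].
Proof.
apply/seteqP; split => x /=.
  move=> cx i /=; rewrite !inE mem_iota add0n /= => ic.
  by rewrite -{1}cx nth_mkseq.
move=> h; apply: (@eq_from_nth _ false); rewrite size_mkseq// => i ic.
by rewrite nth_mkseq//; apply: h; rewrite /= !inE mem_iota.
Qed.

Variable p : R.
Hypothesis Xindep : mutually_independent X.
Hypothesis Xwin : forall i : nat, P [set t | X i t = true] = p%:E.

Let pr (b : bool) : R := if b then p else 1 - p.
Let profit n (x : T) : R := net_profit R n (play x).

Lemma probability_round (i : nat) (b : bool) :
  P (X i @^-1` [set b]) = (pr b)%:E.
Proof.
case: b; first exact: Xwin.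
have -> : X i @^-1` [set false] = ~` [set t | X i t = true].
  by apply/seteqP; split => x /=; case: (X i x).
rewrite probability_setC ?Xwin//.
exact: (measurable_funPTI (X i) (Y := [set true])).
Qed.

Lemma probability_cylinder (c : seq bool) :
  P (cylinder c) = (\prod_(b <- c) pr b)%:E.
Proof.
rewrite cylinder_bigcap (@Xindep _ (fun i => [set nth false c i]))//.
(* The finite set enumerates its elements in an unspecified order. *)
rewrite (perm_big (iota 0 (size c))); last first.
  rewrite (perm_trans (enum_imfset _ _))// map_id.
  apply: uniq_perm; first exact: enum_finmem_uniq.
    exact: iota_uniq.
  exact: enum_finmemE.
under eq_bigr => i _ do rewrite probability_round.
rewrite prodEFin; congr EFin.
by rewrite [RHS](big_nth false) /index_iota subn0.
Qed.

(** Induction on [a + b], the wins still missing after the history [c], which the game is assumed to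
    outlast or just complete. Measurability is carried along because splitting the integral over the
    next round requires it. *)
Lemma integral_net_profit_cylinder (n : nat) (c : seq bool) (a b : nat) :
  (count id c + a = n)%N -> (count negb c + b = n)%N ->
  (forall x, cylinder c x -> (size c <= duration n (play x))%N) ->
  measurable_fun (cylinder c) (profit n) /\
  (\int[P]_(x in cylinder c) (profit n x)%:E =
   (expected_gain p (1 - p) a b * \prod_(r <- c) pr r)%:E)%E.
Proof.
have [m] := ubnP (a + b)%N; elim: m => // m IH in a b c *.
rewrite ltnS => abm ca cb dur.
have mc := measurable_cylinder c.
have [hit|] := boolP ((a == 0%N) || (b == 0%N)).
  have profitE x : x \in cylinder c -> b%:R - a%:R = profit n x.
    rewrite inE => cx; rewrite /profit net_profit_wins.
    have w1 := wins1_cylinder cx.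
    have w2 := wins2_cylinder cx.
    rewrite (duration_eq _ (dur _ cx)) ?w1 ?w2.
      (* Wins obtained and wins missing add up to [n] for either player, so [b - a] is the lead of
         Player 1. *)
      rewrite -(addKr (count id c)%:R a%:R) -(addKr (count negb c)%:R b%:R).
      by rewrite -!natrD ca cb; ring.
    by rewrite /reached w1 w2; lia.
  split.
    exact: (eq_measurable_fun (cst (b%:R - a%:R) : T -> R) profitE
              (measurable_cst _)).
  rewrite (eq_integral (cst (b%:R - a%:R)%:E)) => [|x /profitE <-//].
  rewrite integral_cst//.
  rewrite expected_gain_hit// EFinM; congr (_ * _)%E.
  exact: probability_cylinder.
case: a b abm ca cb => [|a] [|b]// abm ca cb _.
(* Both players still miss a win after [c], so at least one more round is played. *)
have dur' r x : cylinder (rcons c r) x ->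
    (size (rcons c r) <= duration n (play x))%N.
  rewrite cylinder_rcons => -[cx _]; rewrite size_rcons ltn_neqAle dur// andbT.
  apply/eqP => e.
  have : reached n (play x) (size c).
    by rewrite e /duration; case: ex_minnP.
  rewrite /reached (wins1_cylinder cx) (wins2_cylinder cx).
  by lia.
have count_rc q r : count q (rcons c r) = (count q c + q r)%N.
  by rewrite -cats1 count_cat /= addn0.
have [||||mt it] := IH a b.+1 (rcons c true); rewrite ?count_rc;
  [lia..|exact: dur'|].
have [||||mf jf] := IH a.+1 b (rcons c false); rewrite ?count_rc;
  [lia..|exact: dur'|].
have mprofit : measurable_fun
    (cylinder (rcons c true) `|` cylinder (rcons c false)) (profit n).
  by apply/measurable_funU => //; exact: measurable_cylinder.
rewrite cylinder_split; split => //.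
rewrite integral_setU//;
  [|exact: measurable_cylinder..|exact/measurable_EFinP|exact: cylinder_disj].
rewrite it jf -EFinD expected_gainS -!cats1 !big_cat !big_seq1 /=.
by congr EFin; rewrite /pr; ring.
Qed.

End cylinder.

Theorem theorem2p1 (R : realType) (d : measure_display) (T : measurableType d)
    (P : probability T R) (n : nat) (p : R) (X : nat -> {RV P >-> bool})
    (hn : (1 <= n)%N) (hp : 2^-1 <= p < 1)
    (Xindep : mutually_independent X)
    (Xwin : forall i : nat, P [set t : T | X i t = true] = p%:E) :
  let q := 1 - p in
  let mu := p - q in
  let z := p * q in
  ('E_P[fun t : T => net_profit R n (fun i : nat => X i t)])%E =
    (n%:R * mu * \sum_(0 <= j < n) catalan R j * z ^+ j)%:E.
Proof.
move=> q mu z; rewrite -expected_gain_diag ?subrKC//.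
(* The empty history: its cylinder is the whole space and both players miss [n] wins. *)
have [//|//|//|_] := integral_net_profit_cylinder Xindep Xwin (c := [::])
  (n := n) (a := n) (b := n).
by rewrite cylinder_nil big_nil mulr1 unlock.
Qed.
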